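(* Let $\Lambda=\Sigma_{+-}$ be the tent map and let $n\ge2$. Then $$\tfrac12\left(a_n+2^{n-2}\right)\le|\mathcal A_n(\Lambda)|\le a_n-2^{n-2}+1,$$ where $a_n=\sum_{t=1}^{n-1}\psi_2(t)\,2^{n-t-1}$ and $\psi_2(t)$ is the number of primitive binary words of length $t$.
   Context: $\mathcal W_2$ is the set of infinite words $s_1s_2\cdots$ over $\{0,1\}$. The order $\prec_\Lambda$: for $s\ne t$, with $j$ minimal such that $s_j\ne t_j$ and $c$ the number of indices $1\le i<j$ with $s_i=1$, $s\prec_\Lambda t$ iff ($c$ even and $s_j<t_j$) or ($c$ odd and $s_j>t_j$). The tent map is $\Lambda(s_1s_2\cdots)=s_2s_3\cdots$ on $(\mathcal W_2,\prec_\Lambda)$. $\mathrm{Pat}(s,\Lambda,n)$ is the permutation of $[n]$ in the same relative order as $s,\Lambda(s),\dots,\Lambda^{n-1}(s)$ under $\prec_\Lambda$, defined when these are pairwise distinct; $\mathcal A_n(\Lambda)$ is the set of all defined such patterns. A finite word is primitive if it is not a concatenation $r^m$ of $m>1$ copies of a shorter word $r$. *)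

(* Defs.v *)
From mathcomp Require Import all_boot all_order all_algebra all_fingroup.
From mathcomp Require Import boolp.

Set Implicit Arguments.
Unset Strict Implicit.
Unset Printing Implicit Defensive.

(* Infinite binary words, indexed from 0; the letters 0 and 1 are false and
   true. *)
Definition word2 := nat -> bool.

Definition ones (s : word2) (j : nat) : nat := #|[set i : 'I_j | s i]|.

(* The index j in the definition is the first one where s and t differ. *)
Definition tent_lt (s t : word2) : Prop :=
  exists j : nat,
    [/\ forall i, i < j -> s i = t i,
        s j <> t j
      & if odd (ones s j) then (t j : nat) < s j else (s j : nat) < t j].

Definition tent (s : word2) : word2 := fun i => s i.+1.

(* p is the pattern of s of length n: the pattern is defined, and p i < p j
   exactly when the i-th iterate precedes the j-th one.  Positions and values
   run over {0, ..., n-1} instead of {1, ..., n}. *)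
Definition is_pat (s : word2) (n : nat) (p : 'S_n) : Prop :=
  (forall i j : 'I_n, i <> j -> iter i tent s <> iter j tent s) /\
  (forall i j : 'I_n, p i < p j <-> tent_lt (iter i tent s) (iter j tent s)).

Definition allowed (n : nat) : {set 'S_n} :=
  [set p : 'S_n | `[< exists s : word2, is_pat s p >]].

Definition primitive (w : seq bool) : Prop :=
  ~ exists (r : seq bool) (m : nat),
      [/\ 1 < m, size r < size w & w = flatten (nseq m r)].

Definition psi2 (t : nat) : nat := #|[set w : t.-tuple bool | `[< primitive w >]]|.

Definition a (n : nat) : nat := \sum_(1 <= t < n) psi2 t * 2 ^ (n - t - 1).

(* Main.v *)
Require Import Defs.
From mathcomp Require Import all_boot all_order all_algebra all_fingroup.
From mathcomp Require Import boolp.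
From mathcomp Require Import zify lra.

Set Implicit Arguments.
Unset Strict Implicit.
Unset Printing Implicit Defensive.

(* Write a word as w u with a prefix w of length n - 1. For a suffix q of w, the
   words qu and u compare as q^oo and u, so the pattern of w u only depends on w
   and on the position of u among the periodic words q^oo. These are as many as
   there are primitive suffixes q of w, and the lowest interval they cut out is
   empty exactly when w ends with 0; hence there are a_n + 2^(n-2) pairs (w, p)
   with p a pattern of prefix w. A pattern determines all letters of its prefix
   except the one at the position i preceding its peak, the largest of the
   values at the positions after the first, so it has at most two prefixes:
   this is the lower bound. The words x c 1 0^K 1^oo with K large have the same
   pattern for c = 0 and c = 1; running over all x of length < n - 1 this yields
   2^(n-1) - 1 patterns with two prefixes: this is the upper bound. *)

(** * The order on infinite words *)

Definition shift (i : nat) (s : word2) : word2 := fun k => s (i + k).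

Lemma iter_tent i s : iter i tent s = shift i s.
Proof.
elim: i => [|i IHi]; apply/funext => k //=.
by rewrite /tent IHi /shift addnS.
Qed.

Lemma shiftS i s : shift i.+1 s = tent (shift i s).
Proof. by rewrite -!iter_tent. Qed.

Lemma shift_shift i j s : shift i (shift j s) = shift (j + i) s.
Proof. by apply/funext => k; rewrite /shift addnA. Qed.

Lemma shift_at0 i s : shift i s 0 = s i.
Proof. by rewrite /shift addn0. Qed.

Lemma ones_sum s j : ones s j = \sum_(i < j) s i.
Proof.
rewrite /ones cardsE -sum1_card big_mkcond /=; apply: eq_bigr => i _.
by rewrite unfold_in; case: (s i).
Qed.

Lemma onesS s j : ones s j.+1 = s 0 + ones (tent s) j.
Proof. by rewrite !ones_sum big_ord_recl. Qed.

Lemma eq_ones s t j : (forall i, i < j -> s i = t i) -> ones s j = ones t j.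
Proof. by move=> st; rewrite !ones_sum; apply: eq_bigr => i _; rewrite st. Qed.

(** The single equation on [s j] covers both parities: at the first difference the smaller word has
    letter 0 after an even number of ones and letter 1 after an odd number. *)
Definition lt_at (j : nat) (s t : word2) : Prop :=
  [/\ forall i, i < j -> s i = t i, t j = ~~ s j & s j = odd (ones s j)].

Lemma tent_ltP s t : tent_lt s t <-> exists j, lt_at j s t.
Proof.
split=> -[j [st sj h]]; exists j; split=> //.
- by case: (s j) (t j) sj => -[].
- by move: h sj; case: (odd _); case: (s j); case: (t j).
- by rewrite sj; case: (s j).
- by rewrite -h sj; case: (s j).
Qed.

Lemma lt_at_agree j s t s' t' :
  (forall i, i <= j -> s i = s' i) -> (forall i, i <= j -> t i = t' i) ->
  lt_at j s t -> lt_at j s' t'.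
Proof.
move=> ss tt [st tj sj]; split=> [i ij||].
- by rewrite -ss ?(ltnW ij) // -tt ?(ltnW ij) // st.
- by rewrite -ss // -tt.
- by rewrite -ss // sj; congr odd; apply: eq_ones => i ij; rewrite ss // ltnW.
Qed.

Lemma tent_lt_irr s : ~ tent_lt s s.
Proof. by move=> /tent_ltP [j [_ h _]]; case: (s j) h. Qed.

Lemma tent_lt_trans s t r : tent_lt s t -> tent_lt t r -> tent_lt s r.
Proof.
move=> /tent_ltP [i sti] /tent_ltP [j trj]; apply/tent_ltP.
case: (ltngtP i j) => [ij|ji|eij].
- exists i; apply: lt_at_agree sti => // k ki.
  by case: trj => tr _ _; apply: tr; apply: leq_ltn_trans ij.
- exists j; apply: lt_at_agree trj => // k ki.
  by case: sti => st _ _; rewrite st //; apply: leq_ltn_trans ji.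
- subst j; case: sti => st ti si; case: trj => _ _.
  by rewrite ti -(eq_ones st) -si; case: (s i).
Qed.

Lemma tent_lt_asym s t : tent_lt s t -> ~ tent_lt t s.
Proof. by move=> st ts; apply: (@tent_lt_irr s); apply: tent_lt_trans st ts. Qed.

Lemma first_diff (s t : word2) :
  s <> t -> exists2 j, forall i, i < j -> s i = t i & t j = ~~ s j.
Proof.
move=> st; have exd : exists j, s j != t j.
  apply: contra_notP st => h; apply/funext => j.
  by apply/eqP; apply: contra_notT h => ?; exists j.
case: (ex_minnP exd) => j sj minj; exists j.
  by move=> i ij; apply/eqP; apply: contraTT ij => /minj; rewrite -leqNgt.
by case: (s j) (t j) sj => -[].
Qed.

Lemma tent_lt_total s t : s <> t -> tent_lt s t \/ tent_lt t s.
Proof.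
move=> /first_diff [j st tj]; rewrite !tent_ltP.
have [sj|sj] := eqVneq (s j) (odd (ones s j)); first by left; exists j.
right; exists j; split=> [i /st -> //||]; rewrite tj ?negbK //.
rewrite -(eq_ones st); move: sj.
by case: (s j); case: (odd _).
Qed.

Lemma tent_lt_rec s t : tent_lt s t <->
  (if s 0 == t 0 then
     if s 0 then tent_lt (tent t) (tent s) else tent_lt (tent s) (tent t)
   else ~~ s 0).
Proof.
have ones0 (r : word2) : ones r 0 = 0 by rewrite ones_sum big_ord0.
split=> [/tent_ltP [[|j] [st tj sj]]|].
- by rewrite tj sj ones0.
- rewrite -st // eqxx; case s0: (s 0) sj; rewrite onesS s0 => sj;
    apply/tent_ltP; exists j; split.
  + by move=> i ij; rewrite /tent st.
  + by rewrite /tent tj negbK.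
  + have -> : ones (tent t) j = ones (tent s) j.
      by apply: eq_ones => i ij; rewrite /tent st.
    by rewrite /tent tj sj /= negbK.
  + by move=> i ij; rewrite /tent st.
  + by rewrite /tent tj.
  + by rewrite /tent sj.
case: eqP => [st0|st0].
  case s0: (s 0) => /tent_ltP [j [st tj sj]]; apply/tent_ltP; exists j.+1;
    rewrite /tent in st tj sj; split=> [[|i] // ij||].
  - by rewrite st.
  - by rewrite tj negbK.
  - rewrite onesS s0 tj sj /=; congr (~~ odd _).
    by apply: eq_ones => i ij; rewrite /tent st.
  - by rewrite st.
  - by rewrite tj.
  - by rewrite onesS s0 sj.
move=> s0; apply/tent_ltP; exists 0; split=> //.
  by case: (s 0) (t 0) st0 s0 => -[].
by rewrite ones0; apply: negbTE.
Qed.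

(* The tent map turns the order around on the words starting with 1, so the
   comparison of s with a word whose image lies above that of s only depends
   on the first letter of s. *)
Lemma tent_lt_head s t : tent_lt (tent s) (tent t) ->
  (tent_lt s t <-> ~~ s 0) /\ (tent_lt t s <-> s 0).
Proof.
move=> st; have nts := tent_lt_asym st.
rewrite (tent_lt_rec s t) (tent_lt_rec t s) (eq_sym (t 0)).
by case: (s 0) (t 0) => -[].
Qed.

Definition zeros_w : word2 := fun=> false.

Lemma zeros_w_min s : s <> zeros_w -> tent_lt zeros_w s.
Proof.
move=> /nesym /first_diff [j st sj]; apply/tent_ltP; exists j; split=> //.
by rewrite ones_sum big1.
Qed.

(* 1000... *)
Definition top_w : word2 := fun k => k == 0.

Lemma top_w_max s : s <> top_w -> tent_lt s top_w.
Proof.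
move=> sD; apply/tent_lt_rec => /=.
case s0: (s 0) => //=; apply: zeros_w_min => h; apply: sD.
by apply/funext => -[|k] //; rewrite -/(tent s k) h.
Qed.

(** * Concatenation and periodic words *)

Definition catw (x : seq bool) (s : word2) : word2 :=
  fun k => if k < size x then nth false x k else s (k - size x).

Lemma catwE x s k : catw x s (size x + k) = s k.
Proof. by rewrite /catw ltnNge leq_addr addKn. Qed.

Lemma shift_catw i x s : i <= size x -> shift i (catw x s) = catw (drop i x) s.
Proof.
move=> ix; apply/funext => k; rewrite /shift /catw size_drop nth_drop.
by rewrite ltn_subRL; case: ltnP => // h; congr s; lia.
Qed.

Lemma shift_size_catw x s : shift (size x) (catw x s) = s.
Proof. by apply/funext => k; apply: catwE. Qed.

Lemma catw_mkseq s k : catw (mkseq s k) (shift k s) = s.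
Proof.
apply/funext => i; rewrite /catw size_mkseq; case: ltnP => ik.
  by rewrite nth_mkseq.
by rewrite /shift subnKC.
Qed.

Lemma tent_lt_catw x s t : ~~ odd (count id x) ->
  tent_lt s t -> tent_lt (catw x s) (catw x t).
Proof.
(* Both parities go through the induction together, since prepending a 1 exchanges them. *)
have: if odd (count id x) then tent_lt s t -> tent_lt (catw x t) (catw x s)
      else tent_lt s t -> tent_lt (catw x s) (catw x t).
  have e0 (r : word2) : catw [::] r = r.
    by apply/funext => k; rewrite /catw subn0.
  elim: x => [|b x IHx] /=; first by rewrite !e0.
  rewrite oddD; case: b; case: (odd _) IHx => /= IHx st; apply/tent_lt_rec;
    rewrite eqxx /=; exact: IHx.
by case: (odd _).
Qed.

Definition perw (q : seq bool) : word2 := fun k => nth false q (k %% size q).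

Lemma perwD q k c : perw q (k + c * size q) = perw q k.
Proof. by rewrite /perw addnC modnMDl. Qed.

Lemma perw_shift q c : shift (c * size q) (perw q) = perw q.
Proof. by apply/funext => k; rewrite /shift addnC perwD. Qed.

Lemma catw_perw q : catw q (perw q) = perw q.
Proof.
apply/funext => k; rewrite /catw; case: ltnP => kq.
  by rewrite /perw modn_small.
by rewrite -(perwD q _ 1) mul1n subnK.
Qed.

Lemma catw_fix q u : q <> [::] -> catw q u = u -> u = perw q.
Proof.
move=> q0 qu; apply/funext => k; elim/ltn_ind: k => k IHk.
rewrite -qu /catw; case: ltnP => kq; first by rewrite /perw modn_small.
rewrite IHk; first by rewrite -(perwD q _ 1) mul1n subnK.
by case: q q0 kq {qu IHk} => //= b q _ kq; lia.
Qed.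

(* At the first disagreement of u with q^oo, qu still follows q^oo. *)
Lemma tent_lt_catw_self q u : q <> [::] -> u <> perw q ->
  (tent_lt (catw q u) u <-> tent_lt (perw q) u) /\
  (tent_lt u (catw q u) <-> tent_lt u (perw q)).
Proof.
move=> q0 uq.
have agree j : (forall i, i < j -> u i = perw q i) ->
    forall i, i <= j -> catw q u i = perw q i.
  move=> uqj i ij; rewrite -[in RHS]catw_perw /catw; case: ltnP => // iq.
  by apply: uqj; case: q q0 iq {uq} => //= b q _ iq; lia.
have L : tent_lt (perw q) u -> tent_lt (catw q u) u.
  move=> /tent_ltP [j h]; apply/tent_ltP; exists j.
  case: (h) => hq _ _; apply: lt_at_agree h => // i ij.
  by rewrite (agree j) // => k kj; rewrite hq.
have R : tent_lt u (perw q) -> tent_lt u (catw q u).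
  move=> /tent_ltP [j h]; apply/tent_ltP; exists j.
  case: (h) => hq _ _; apply: lt_at_agree h => // i ij.
  by rewrite (agree j).
split; split; auto.
  move=> h; case: (tent_lt_total uq) => // /R h'.
  by case: (tent_lt_asym h h').
move=> h; case: (tent_lt_total uq) => // /L h'.
by case: (tent_lt_asym h h').
Qed.

(** Both words have the period [size q * size q'], so one such stretch determines them. *)
Lemma perw_eq q q' :
  (forall k, k < size q * size q' -> perw q k = perw q' k) ->
  0 < size q -> 0 < size q' -> perw q = perw q'.
Proof.
move=> h q0 q0'; apply/funext => k.
pose N := size q * size q'.
have h1 : k = k %% N + (k %/ N * size q') * size q.
  by rewrite -mulnA (mulnC (size q')) addnC -divn_eq.
have h2 : k = k %% N + (k %/ N * size q) * size q'.
  by rewrite -mulnA addnC -divn_eq.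
rewrite [in LHS]h1 [in RHS]h2 !perwD h //.
by rewrite ltn_mod muln_gt0 q0.
Qed.

Lemma flatten_nseq_nth (r : seq bool) c k : k < c * size r ->
  nth false (flatten (nseq c r)) k = perw r k.
Proof.
elim: c k => [|c IHc] k //=; rewrite mulSn nth_cat => kc; case: ltnP => kr.
  by rewrite /perw modn_small.
rewrite IHc; last lia.
by rewrite -(perwD r _ 1) mul1n subnK.
Qed.

Lemma size_flatten_nseq (r : seq bool) c : size (flatten (nseq c r)) = c * size r.
Proof. by rewrite size_flatten /shape map_nseq sumn_nseq mulnC. Qed.

Lemma perw_flatten_nseq r c : 0 < c -> perw (flatten (nseq c r)) = perw r.
Proof.
case: r => [|b r] c0.
  by apply/funext => k; rewrite /perw !nth_default ?size_flatten_nseq ?muln0.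
apply/funext => k; rewrite {1}/perw size_flatten_nseq flatten_nseq_nth.
  rewrite {2}(divn_eq k (c * size (b :: r))) addnC mulnA perwD //.
by rewrite ltn_mod muln_gt0 c0.
Qed.

(** The common infinite word has both lengths as periods, hence also their gcd [d]. If [d] were less
    than [size q], then [q] would be a power of its prefix of length [d]. *)
Lemma primitive_perw_size q q' : 0 < size q -> 0 < size q' -> primitive q ->
  perw q = perw q' -> size q %| size q'.
Proof.
move=> q0 q0' pq e; set d := gcdn (size q) (size q').
have d0 : 0 < d by rewrite gcdn_gt0 q0.
have per_d k : perw q (k + d) = perw q k.
  (* Bezout: [c * size q = c' * size q' + d]. *)
  case: (egcdnP (size q') q0) => c c' E _.
  rewrite -(perwD q (k + d) 0) mul0n addn0.
  rewrite -[in RHS](perwD q k c) E e -[in LHS](perwD q' (k + d) c').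
  by congr perw; rewrite /d; lia.
have per_dM k c : perw q (k + c * d) = perw q k.
  elim: c => [|c IHc]; first by rewrite mul0n addn0.
  by rewrite mulSnr addnA per_d.
apply/gcdn_idPl; rewrite -/d; apply/eqP; apply/negPn/negP => dq; apply: pq.
have ddiv : d %| size q by apply: dvdn_gcdl.
have dle : d < size q by rewrite ltn_neqAle dq dvdn_leq.
have st : size (take d q) = d by rewrite size_takel // ltnW.
exists (take d q), (size q %/ d); split.
- by rewrite ltn_divRL ?mul1n.
- by rewrite st.
apply: (@eq_from_nth _ false); first by rewrite size_flatten_nseq st divnK.
move=> k kq; rewrite flatten_nseq_nth ?st ?divnK // /perw st.
rewrite nth_take ?ltn_mod //.
have qE j : j < size q -> nth false q j = perw q j.
  by move=> h; rewrite /perw modn_small.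
rewrite (qE _ kq) (qE (k %% d)); last by rewrite (ltn_trans _ dle) ?ltn_mod.
by rewrite {1}(divn_eq k d) addnC per_dM.
Qed.

(** * Patterns *)

Lemma is_patP (s : word2) n (p : 'S_n) : is_pat s p <->
  (forall i j : 'I_n, i <> j -> shift i s <> shift j s) /\
  (forall i j : 'I_n, p i < p j <-> tent_lt (shift i s) (shift j s)).
Proof.
by rewrite /is_pat; split=> -[h1 h2]; split=> i j;
  rewrite ?iter_tent; move: (h1 i j) (h2 i j); rewrite ?iter_tent.
Qed.

(** The value at a position is the number of shifts strictly below the one starting there. *)
Lemma is_pat_ex (s : word2) n :
  (forall i j : 'I_n, i <> j -> shift i s <> shift j s) ->
  exists p : 'S_n, is_pat s p.
Proof.
move=> inj_s.
pose below (i : 'I_n) := [set j : 'I_n | `[< tent_lt (shift j s) (shift i s) >]].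
have belowE i j : j \in below i = `[< tent_lt (shift j s) (shift i s) >].
  by rewrite inE.
have below_lt i : #|below i| < n.
  rewrite -[n in _ < n]card_ord; apply: proper_card; apply/properP.
  split; first exact/subsetP.
  by exists i => //; rewrite belowE; apply/asboolP/tent_lt_irr.
have below_mono (i j : 'I_n) :
    tent_lt (shift i s) (shift j s) -> #|below i| < #|below j|.
  move=> ij; apply: proper_card; apply/properP; split.
    apply/subsetP => k; rewrite !belowE => /asboolP ki; apply/asboolP.
    exact: tent_lt_trans ki ij.
  exists i; rewrite belowE; first exact/asboolP.
  exact/asboolP/tent_lt_irr.
pose f i := Ordinal (below_lt i).
have f_lt (i j : 'I_n) : f i < f j <-> tent_lt (shift i s) (shift j s).
  split=> [/= fij|/below_mono //].
  have [e|/eqP ne] := eqVneq i j; first by rewrite e ltnn in fij.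
  case: (tent_lt_total (inj_s _ _ ne)) => // /below_mono.
  by rewrite ltnNge ltnW.
have f_inj : injective f.
  move=> i j fij; apply/eqP; apply/negPn/negP => /eqP ne.
  by case: (tent_lt_total (inj_s _ _ ne)) => /f_lt; rewrite fij ltnn.
exists (perm f_inj); apply/is_patP; split=> // i j.
by rewrite !permE.
Qed.

(** Each value is the number of positions with smaller values, hence is read off from the order. *)
Lemma perm_eq_order n (p p' : 'S_n) :
  (forall i j, (p i < p j) = (p' i < p' j)) -> p = p'.
Proof.
have rank (r : 'S_n) i : (r i : nat) = #|[set j | r j < r i]|.
  have -> : [set j | r j < r i] = r @^-1: [set k : 'I_n | k < r i].
    by apply/setP => j; rewrite !inE.
  rewrite card_preimset; last exact: perm_inj.
  rewrite cardsE -sum1_card /=.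
  rewrite (big_ord_narrow (F := fun=> 1) (ltnW (ltn_ord (r i)))).
  by rewrite sum1_card card_ord.
move=> h; apply/permP => i; apply: val_inj; rewrite /= (rank p) (rank p').
by apply: eq_card => j; rewrite !inE h.
Qed.

Lemma is_pat_uniq n s s' (p p' : 'S_n) : is_pat s p -> is_pat s' p' ->
  (forall i j : 'I_n, tent_lt (shift i s) (shift j s) <->
                      tent_lt (shift i s') (shift j s')) -> p = p'.
Proof.
move=> /is_patP [_ h] /is_patP [_ h'] ss'; apply: perm_eq_order => i j.
by apply/idP/idP => [/h /ss' /h'|/h' /ss' /h].
Qed.

Section Prefix.

Variables (m : nat) (w : m.-tuple bool).

Lemma drop_prefix_neq0 i : i < m -> drop i w <> [::].
Proof. by move=> im /(congr1 size); rewrite size_drop size_tuple /=; lia. Qed.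

Lemma size_drop_gt0 i : i < m -> 0 < size (drop i w).
Proof. by move=> im; rewrite size_drop size_tuple subn_gt0. Qed.

Lemma shift_prefix i u : i <= m -> shift i (catw w u) = catw (drop i w) u.
Proof. by move=> im; rewrite shift_catw ?size_tuple. Qed.

Lemma shift_prefix_all u : shift m (catw w u) = u.
Proof. by rewrite -{1}(size_tuple w) shift_size_catw. Qed.

(** With n = m + 1, the last of the n iterates is the tail [u]. Two equal iterates, shifted on until
    the later one is [u], give qu = u for a suffix q of [w], that is, u = q^oo. *)
Lemma distinct_shiftsP u :
  (forall i j : 'I_m.+1, i <> j -> shift i (catw w u) <> shift j (catw w u)) <->
  (forall i, i < m -> u <> perw (drop i w)).
Proof.
split=> [h i im uE|h].
  have := h (widen_ord (leqnSn m) (Ordinal im)) ord_max.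
  rewrite /= shift_prefix_all shift_prefix ?(ltnW im) // {1}uE catw_perw.
  by apply=> //; move=> /(congr1 val) /= e; rewrite e ltnn in im.
have wlt (i j : 'I_m.+1) : i < j -> shift i (catw w u) <> shift j (catw w u).
  move=> ij /(congr1 (shift (m - j))); rewrite !shift_shift.
  have jm : j <= m by rewrite -ltnS.
  rewrite (subnKC jm) shift_prefix_all => e.
  have lt_im : i + (m - j) < m by lia.
  apply: (h _ lt_im); apply: catw_fix; first exact: drop_prefix_neq0.
  by rewrite -shift_prefix ?(ltnW lt_im).
move=> i j /eqP; rewrite -val_eqE neq_ltn => /orP [/wlt //|/wlt ji e].
exact: ji.
Qed.

Lemma is_pat_good u (p : 'S_m.+1) : is_pat (catw w u) p ->
  forall i, i < m -> u <> perw (drop i w).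
Proof. by move=> /is_patP [/distinct_shiftsP]. Qed.

Lemma good_is_pat u : (forall i, i < m -> u <> perw (drop i w)) ->
  exists p : 'S_m.+1, is_pat (catw w u) p.
Proof. by move=> h; apply: is_pat_ex; apply/distinct_shiftsP. Qed.

Lemma shift_lt_tail u i : (forall i, i < m -> u <> perw (drop i w)) -> i < m ->
  (tent_lt (shift i (catw w u)) u <-> tent_lt (perw (drop i w)) u) /\
  (tent_lt u (shift i (catw w u)) <-> tent_lt u (perw (drop i w))).
Proof.
move=> h im; rewrite shift_prefix ?(ltnW im) //.
by apply: tent_lt_catw_self; [apply: drop_prefix_neq0|apply: h].
Qed.

(** The tail starts at position m, so comparing the values at i and m tells whether q^oo lies below
    [u]. Conversely, these comparisons settle every pair that involves position m, and the other
    pairs reduce to such pairs letter by letter. *)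
Lemma is_pat_below u u' (p p' : 'S_m.+1) :
  is_pat (catw w u) p -> is_pat (catw w u') p' ->
  (p = p' <-> forall i, i < m ->
     (tent_lt (perw (drop i w)) u <-> tent_lt (perw (drop i w)) u')).
Proof.
move=> pu pu'; have gu := is_pat_good pu; have gu' := is_pat_good pu'.
split=> [pp' i im|below].
  have [[hi _] [hi' _]] := (shift_lt_tail gu im, shift_lt_tail gu' im).
  rewrite -hi -hi' -[in X in tent_lt _ X <-> _](shift_prefix_all u).
  rewrite -[in X in _ <-> tent_lt _ X](shift_prefix_all u').
  case/is_patP: pu => _ /(_ (inord i) ord_max).
  case/is_patP: pu' => _ /(_ (inord i) ord_max).
  by rewrite inordK ?ltnS ?(ltnW im) // pp' => -> ->.
apply: is_pat_uniq pu pu' _ => i j.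
(* Neither tail is one of the periodic words, so not being above one means being below it. *)
have above k : k < m ->
    (tent_lt u (perw (drop k w)) <-> tent_lt u' (perw (drop k w))).
  move=> km; split=> h.
    case: (tent_lt_total (gu' k km)) => // /below h'.
    by case: (tent_lt_asym h (h' km)).
  case: (tent_lt_total (gu k km)) => // /below h'.
  by case: (tent_lt_asym h (h' km)).
move: (nat_of_ord i) (nat_of_ord j) (ltn_ord i) (ltn_ord j) => {}i {}j.
rewrite !ltnS => im jm.
(* [d] bounds the distance from the larger position to m. Different first letters decide; equal ones
   move both positions one step on, with the same effect for [u] and [u'] since the letters come
   from [w]. *)
have [d] : exists d, m <= maxn i j + d by exists m; apply: leq_addl.
elim: d i j im jm => [|d IHd] i j im jm hd.
all: have [ei|im'] := eqVneq i m; last have {}im : i < m by rewrite ltn_neqAle im'.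
all: have [ej|jm'] := eqVneq j m; last have {}jm : j < m by rewrite ltn_neqAle jm'.
all: rewrite ?ei ?ej ?shift_prefix_all.
all: try by split=> /tent_lt_irr.
all: try by have [[_ ->] [_ ->]] := (shift_lt_tail gu jm, shift_lt_tail gu' jm);
       apply: above.
all: try by have [[-> _] [-> _]] := (shift_lt_tail gu im, shift_lt_tail gu' im);
       apply: below.
  by lia.
have at_w k v : k < m -> catw w v k = nth false w k.
  by move=> km; rewrite /catw size_tuple km.
rewrite [X in X <-> _]tent_lt_rec [X in _ <-> X]tent_lt_rec.
rewrite !shift_at0 !at_w // -!shiftS.
by case: eqP => // _; case: (nth _ _ _); apply: IHd => //; lia.
Qed.

End Prefix.

(** * Counting the patterns with a given prefix *)

(* The even number of periods makes the common prefix orientation preserving. *)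
Definition just_above (q : seq bool) (L : nat) : word2 :=
  catw (mkseq (perw q) (2 * L * size q)) top_w.

Lemma just_above_gt q L : 0 < size q -> tent_lt (perw q) (just_above q L).
Proof.
move=> q0; rewrite -[X in tent_lt X _](catw_mkseq (perw q) (2 * L * size q)).
rewrite perw_shift; apply: tent_lt_catw.
  (* The prefix is the same block of [L] periods taken twice, so its number of ones is even. *)
  rewrite -mulnA mul2n -addnn /mkseq iotaD add0n map_cat count_cat.
  rewrite -{2}(addn0 (L * size q)) iotaDl -map_comp.
  have perL : perw q \o addn (L * size q) =1 perw q.
    by move=> k /=; rewrite addnC perwD.
  by rewrite (eq_map perL) addnn odd_double.
apply: top_w_max => e; have : perw q (0 + 1 * size q) = perw q 0 by rewrite perwD.
by rewrite e add0n mul1n /top_w; case: (size q) q0.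
Qed.

(** The 1 that starts [top_w] is followed by zeros only, so it does not recur [size q'] letters
    later. *)
Lemma just_above_aperiodic q q' L : 0 < size q' -> just_above q L <> perw q'.
Proof.
move=> q0 e; set N := 2 * L * size q.
have : perw q' (N + 1 * size q') = perw q' N by rewrite perwD.
have sN : size (mkseq (perw q) N) = N by rewrite size_mkseq.
rewrite -e mul1n /just_above -[in RHS](addn0 N) -sN !catwE /top_w /=.
by case: (size q') q0.
Qed.

(** Distinct periodic words differ within [size q * size q'] letters, and the bound on [L] makes
    [just_above q L] follow q^oo that long. *)
Lemma just_above_lt q q' L : 0 < size q -> 0 < size q' -> size q' <= 2 * L ->
  tent_lt (perw q) (perw q') -> tent_lt (just_above q L) (perw q').
Proof.
move=> q0 q0' qL /tent_ltP [j h]; apply/tent_ltP; exists j.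
have jlt : j < 2 * L * size q.
  have sz : size q * size q' <= 2 * L * size q by rewrite mulnC leq_mul2r qL orbT.
  apply: leq_trans sz; rewrite ltnNge; apply/negP => jle.
  case: h => hj hj' _; have e : perw q = perw q'.
    by apply: perw_eq => // k kq; apply: hj; apply: leq_trans jle.
  by rewrite e in hj'; case: (perw q' j) hj'.
apply: lt_at_agree h => // i ij.
rewrite /just_above /catw size_mkseq (leq_ltn_trans ij jlt) nth_mkseq //.
exact: leq_ltn_trans jlt.
Qed.

(** An element with the most elements below it is maximal. *)
Lemma finite_max (T : finType) (r : rel T) (P : pred T) (x0 : T) :
  irreflexive r -> transitive r -> P x0 ->
  exists2 x, P x & forall y, P y -> ~~ r x y.
Proof.
move=> irr tr Px0; pose F x := #|[set y | r y x]|.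
case: (arg_maxnP F Px0) => x Px maxx; exists x => // y Py.
apply/negP => rxy; have : F y <= F x := maxx y Py; rewrite leqNgt => /negP; apply.
apply: proper_card; apply/properP; split.
  by apply/subsetP => z; rewrite !inE => rzx; apply: tr rzx rxy.
by exists x; rewrite !inE ?irr.
Qed.

Definition prefix_pats m (w : m.-tuple bool) : {set 'S_m.+1} :=
  [set p : 'S_m.+1 | `[< exists u, is_pat (catw w u) p >]].

Definition primitive_suffixes m (w : m.-tuple bool) : {set 'I_m} :=
  [set i : 'I_m | `[< primitive (drop i w) >]].

(** By primitivity each length divides the other. *)
Lemma primitive_suffix_inj m (w : m.-tuple bool) (i k : 'I_m) :
  primitive (drop i w) -> primitive (drop k w) ->
  perw (drop i w) = perw (drop k w) -> i = k.
Proof.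
move=> pi pk e; apply: val_inj.
have i0 := size_drop_gt0 w (ltn_ord i); have k0 := size_drop_gt0 w (ltn_ord k).
have : size (drop i w) == size (drop k w).
  by rewrite eqn_dvd !primitive_perw_size.
by rewrite !size_drop size_tuple /=; have := ltn_ord i; have := ltn_ord k; lia.
Qed.

(* The primitive root of a suffix is itself a suffix. *)
Lemma primitive_suffix_ex m (w : m.-tuple bool) (i : 'I_m) :
  exists2 k : 'I_m, primitive (drop k w) & perw (drop k w) = perw (drop i w).
Proof.
pose P (k : 'I_m) := `[< perw (drop k w) = perw (drop i w) >].
have Pi : P i by apply/asboolP.
(* The latest start gives the shortest suffix with this periodic word. Were it a proper power of r,
   its last block r would be a shorter such suffix. *)
case: (arg_maxnP (fun k : 'I_m => k : nat) Pi) => k /asboolP ki maxk.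
exists k => // -[r [c [c1 rk kE]]].
have k0 := size_drop_gt0 w (ltn_ord k).
have szk : size (drop k w) = c * size r by rewrite {1}kE size_flatten_nseq.
have r0 : 0 < size r by move: k0; rewrite szk muln_gt0 => /andP[].
have rE : r = drop (m - size r) w.
  have ck : c.-1 * size r <= size (drop k w) by rewrite szk leq_mul2r leq_pred orbT.
  have -> : m - size r = c.-1 * size r + k.
    move: szk; rewrite size_drop size_tuple => szk.
    have := ltn_ord k; case: (c) c1 szk => // c' _; rewrite mulSn /=; lia.
  rewrite -drop_drop kE; case: (c) c1 => // c' _.
  have -> : nseq c'.+1 r = nseq c' r ++ [:: r] by rewrite -addn1 nseqD.
  rewrite flatten_cat /= cats0 -(size_flatten_nseq r c').
  by rewrite drop_size_cat.
have rm : m - size r < m by have := ltn_ord k; lia.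
have := maxk (Ordinal rm); rewrite /P /= -rE -ki kE perw_flatten_nseq ?(ltnW c1) //.
rewrite asboolT // => /(_ isT).
by move: rk; rewrite size_drop size_tuple; have := ltn_ord k; lia.
Qed.

(** This labels the interval containing [u] by a primitive suffix: a greatest q^oo below [u] is
    taken, and q is replaced by its primitive root. *)
Lemma suffix_lt_tail_ex m (w : m.-tuple bool) u :
  (exists2 i, i < m & tent_lt (perw (drop i w)) u) ->
  exists2 k : 'I_m, primitive (drop k w) &
    tent_lt (perw (drop k w)) u /\
    forall i : 'I_m, tent_lt (perw (drop i w)) u ->
      ~ tent_lt (perw (drop k w)) (perw (drop i w)).
Proof.
case=> i0 i0m i0u.
pose r (i k : 'I_m) := `[< tent_lt (perw (drop i w)) (perw (drop k w)) >].
case: (@finite_max _ r (fun i => `[< tent_lt (perw (drop i w)) u >])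
         (Ordinal i0m)).
- by move=> i; apply/asboolP/tent_lt_irr.
- move=> j i k /asboolP ij /asboolP jk; apply/asboolP.
  exact: tent_lt_trans ij jk.
- exact/asboolP.
move=> i /asboolP iu maxi; case: (primitive_suffix_ex w i) => k pk ki.
exists k => //; rewrite ki; split=> // j /asboolP /maxi /asboolP.
by [].
Qed.

Lemma last_letter m (w : m.+1.-tuple bool) : drop m w = [:: nth false w m].
Proof.
by rewrite (drop_nth false) ?size_tuple // drop_oversize ?size_tuple.
Qed.

(** Every such periodic word contains the last letter of [w], which is a 1. *)
Lemma zeros_w_good m (w : m.+1.-tuple bool) : nth false w m ->
  forall i, i < m.+1 -> zeros_w <> perw (drop i w).
Proof.
move=> wm i im /(congr1 (fun s => s (m - i))).
rewrite /perw size_drop size_tuple modn_small ?nth_drop ?subnKC ?wm //.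
by lia.
Qed.

(** Each primitive suffix contributes the pattern of a tail just above its periodic word. There
    remain the tails below all periodic words: 0^oo is one if [w] ends with 1, and there is none if
    [w] ends with 0, because 0^oo is then itself the periodic word of the last letter. *)
Lemma card_prefix_pats m (w : m.+1.-tuple bool) :
  #|prefix_pats w| = #|primitive_suffixes w| + nth false w m.
Proof.
(* Taking [L] to be the length of [w] meets the bound in [just_above_lt] for every suffix. *)
pose ua (i : 'I_m.+1) := just_above (drop i w) m.+1.
have ua_good i k : k < m.+1 -> ua i <> perw (drop k w).
  by move=> km; apply: just_above_aperiodic; apply: size_drop_gt0.
have ua_below (i k : 'I_m.+1) : tent_lt (perw (drop k w)) (ua i) <->
    ~ tent_lt (perw (drop i w)) (perw (drop k w)).
  have i0 := size_drop_gt0 w (ltn_ord i); have k0 := size_drop_gt0 w (ltn_ord k).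
  have gt := just_above_gt m.+1 i0.
  split=> [ku ik|nik].
    apply: tent_lt_asym ku _; apply: just_above_lt => //.
    by rewrite size_drop size_tuple; lia.
  have [<-//|ne] := pselect (perw (drop i w) = perw (drop k w)).
  by case: (tent_lt_total ne) => // ki; apply: tent_lt_trans ki gt.
have [f f_pat] := boolp.choice (fun i => good_is_pat (ua_good i)).
have f_in i : f i \in prefix_pats w by rewrite inE; apply/asboolP; exists (ua i).
have f_inj : {in primitive_suffixes w &, injective f}.
  move=> i k; rewrite !inE => /asboolP pi /asboolP pk fik.
  apply: (primitive_suffix_inj pi pk).
  have below := (is_pat_below (f_pat i) (f_pat k)).1 fik.
  have [//|ne] := pselect (perw (drop i w) = perw (drop k w)).
  have self (j : 'I_m.+1) : tent_lt (perw (drop j w)) (ua j).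
    by apply/ua_below/tent_lt_irr.
  (* The greater periodic word lies below its own tail but not below the tail just above the smaller
     one. *)
  case: (tent_lt_total ne) => h; exfalso.
    by case/ua_below: ((below k (ltn_ord k)).2 (self k)).
  by case/ua_below: ((below i (ltn_ord i)).1 (self i)).
have f_onto u p : is_pat (catw w u) p ->
    (exists2 i, i < m.+1 & tent_lt (perw (drop i w)) u) ->
    p \in f @: primitive_suffixes w.
  move=> pu /suffix_lt_tail_ex [k pk [ku maxk]].
  apply/imsetP; exists k; first by rewrite inE; apply/asboolP.
  apply/(is_pat_below pu (f_pat k)) => i im.
  rewrite -[i]/(nat_of_ord (Ordinal im)) ua_below; split; first exact: maxk.
  move=> nki; have [<-//|ne] :=
    pselect (perw (drop k w) = perw (drop (Ordinal im) w)).
  by case: (tent_lt_total ne) => // ik; apply: tent_lt_trans ik ku.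
rewrite -(card_in_imset f_inj); case wm: (nth false w m); last first.
  rewrite addn0; apply: eq_card => p; apply/idP/idP; last first.
    by case/imsetP=> i _ ->.
  rewrite inE => /asboolP [u pu]; apply: (f_onto u) => //.
  exists m => //; have e : perw (drop m w) = zeros_w.
    by apply/funext => k; rewrite /perw last_letter wm /= modn1.
  by rewrite e; apply: zeros_w_min; rewrite -e; apply: (is_pat_good pu).
have [p0 pat0] := good_is_pat (zeros_w_good wm).
have none i : ~ tent_lt (perw (drop i w)) zeros_w.
  move=> h; have [e|/zeros_w_min] := pselect (perw (drop i w) = zeros_w).
    by move: h; rewrite e => /tent_lt_irr.
  exact: tent_lt_asym h.
have p0_new : p0 \notin f @: primitive_suffixes w.
  apply/imsetP => -[k _ e].
  have /(_ k (ltn_ord k)) := (is_pat_below pat0 (f_pat k)).1 e.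
  by rewrite ua_below => -[_ h]; apply: (none k); apply: h; apply: tent_lt_irr.
transitivity #|p0 |: f @: primitive_suffixes w|; last first.
  by rewrite cardsU1 p0_new addnC.
apply: eq_card => p; rewrite in_setU1; apply/idP/idP; last first.
  case/orP => [/eqP ->|/imsetP [i _ ->] //].
  by rewrite inE; apply/asboolP; exists zeros_w.
rewrite inE => /asboolP [u pu].
have [h|h] := pselect (exists2 i, i < m.+1 & tent_lt (perw (drop i w)) u).
  by rewrite (f_onto u) ?orbT.
apply/orP; left; apply/eqP; apply/(is_pat_below pu pat0) => i im.
by split=> [iu|/none //]; case: h; exists i.
Qed.

(** The first [i] letters are free. *)
Lemma card_tuple_suffix (P : pred (seq bool)) m i : i <= m ->
  #|[set w : m.-tuple bool | P (drop i w)]| =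
  2 ^ i * #|[set v : (m - i).-tuple bool | P v]|.
Proof.
move=> im; have e := subnKC im; move: (m - i) e => k e; subst m.
pose f (xv : i.-tuple bool * k.-tuple bool) := [tuple of xv.1 ++ xv.2].
have f_inj : injective f.
  move=> [x v] [x' v'] /(congr1 val) /= /eqP.
  rewrite eqseq_cat ?size_tuple // => /andP[/eqP/val_inj -> /eqP/val_inj ->].
  by [].
transitivity #|f @: setX setT [set v : k.-tuple bool | P v]|; last first.
  by rewrite card_imset // cardsX cardsT card_tuple card_bool.
apply: eq_card => w; rewrite inE; apply/idP/imsetP => [Pw|[[x v]]].
  have sx : size (take i w) == i by rewrite size_takel ?size_tuple ?leq_addr.
  have sv : size (drop i w) == k by rewrite size_drop size_tuple addKn.
  exists (Tuple sx, Tuple sv); first by rewrite !inE.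
  by apply: val_inj; rewrite /= cat_take_drop.
by rewrite !inE /= => Pv -> /=; rewrite drop_size_cat ?size_tuple.
Qed.

(** After exchanging the sums, the suffix starting at i has length t = m - i and is primitive for
    psi2(t) 2^i words; for n = m + 1 the exponent n - t - 1 is i. *)
Lemma sum_primitive_suffixes m :
  \sum_(w : m.-tuple bool) #|primitive_suffixes w| = a m.+1.
Proof.
have mem_sum (w : m.-tuple bool) : #|primitive_suffixes w| =
    \sum_(i < m) (`[< primitive (drop i w) >] : nat).
  rewrite -sum1_card big_mkcond /=; apply: eq_bigr => i _; rewrite inE.
  by case: (`[< _ >]).
rewrite (eq_bigr _ (fun w _ => mem_sum w)) exchange_big /= /a big_add1 big_mkord /=.
rewrite [RHS](reindex_inj rev_ord_inj) /=; apply: eq_bigr => i _.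
have im := ltn_ord i; have -> : (m - i.+1).+1 = m - i by lia.
have -> : m.+1 - (m - i) - 1 = i by lia.
rewrite mulnC -(card_tuple_suffix (fun v => `[< primitive v >]) (ltnW im)).
rewrite -sum1_card [RHS]big_mkcond /=; apply: eq_bigr => w _; rewrite inE.
by case: (`[< _ >]).
Qed.

Lemma sum_last_letter m : \sum_(w : m.+1.-tuple bool) nth false w m = 2 ^ m.
Proof.
transitivity #|[set w : m.+1.-tuple bool | nth false (drop m w) 0]|.
  rewrite -sum1_card [RHS]big_mkcond /=; apply: eq_bigr => w _; rewrite inE.
  by rewrite nth_drop addn0; case: (nth _ _ _).
rewrite (card_tuple_suffix (fun v => nth false v 0)) //.
have -> : m.+1 - m = 1 by lia.
rewrite -[RHS]muln1; congr (_ * _).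
transitivity #|[set [tuple true]]|; last by rewrite cards1.
apply: eq_card => v; rewrite !inE; case/tupleP: v => b v.
by rewrite tuple0 -val_eqE; case: b.
Qed.

(** * The prefixes of a pattern *)

(* p takes its largest value on the positions 1, ..., n-1 at i+1 *)
Definition peak m (p : 'S_m.+1) (i : 'I_m) : Prop :=
  forall j : 'I_m, j <> i -> p (lift ord0 j) < p (lift ord0 i).

Lemma peak_ex m (p : 'S_m.+2) : exists i : 'I_m.+1, peak p i.
Proof.
case: (@arg_maxnP _ (ord0 : 'I_m.+1) xpredT (fun i => p (lift ord0 i)) isT).
move=> i _ maxi.
exists i => j ji; rewrite ltn_neqAle; apply/andP; split; last exact: maxi.
by apply/negP => /eqP /val_inj /perm_inj /lift_inj.
Qed.

Lemma peak_uniq m (p : 'S_m.+1) i j : peak p i -> peak p j -> i = j.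
Proof.
move=> pi pj; apply/eqP/negPn/negP => /eqP ij.
have := pi j (nesym ij); rewrite ltnNge => /negP; apply.
exact: ltnW (pj i ij).
Qed.

(** The shift at k + 1 lies below the one at i + 1, so by [tent_lt_head] the order of the shifts at
    k and i reveals the letter at k. *)
Lemma peak_letter m s (p : 'S_m.+1) i : is_pat s p -> peak p i ->
  forall k : 'I_m, k <> i ->
  s k = ~~ (p (widen_ord (leqnSn m) k) < p (widen_ord (leqnSn m) i)).
Proof.
move=> /is_patP [_ h] pk k ki; have /h := pk k ki.
rewrite !lift0 !shiftS => /tent_lt_head [hk _].
apply/idP/idP => [sk|].
  by apply/negP => /h /= /hk; rewrite shift_at0 sk.
by apply: contraNT => sk; apply/h/hk; rewrite shift_at0.
Qed.

Definition pat_prefixes m (p : 'S_m.+1) : {set m.-tuple bool} :=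
  [set w | p \in prefix_pats w].

(** All letters but the one at the peak index are forced, so reading that letter is injective on the
    prefixes. *)
Lemma pat_prefixes_le2 m (p : 'S_m.+2) : #|pat_prefixes p| <= 2.
Proof.
have [i pki] := peak_ex p; rewrite -card_bool -cardsT.
apply: (leq_trans _ (subset_leq_card (subsetT
  ((fun w : m.+1.-tuple bool => tnth w i) @: pat_prefixes p)))).
rewrite card_in_imset // => w w'; rewrite !inE.
move=> /asboolP [u pu] /asboolP [u' pu'] e; apply: eq_from_tnth => k.
have [->//|/eqP ki] := eqVneq k i.
have := peak_letter pu pki ki; have := peak_letter pu' pki ki.
by rewrite /catw !size_tuple !ltn_ord !(tnth_nth false) => <- <-.
Qed.

Lemma allowed_prefixes m (p : 'S_m.+1) :
  p \in allowed m.+1 = (0 < #|pat_prefixes p|).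
Proof.
rewrite inE card_gt0; apply/asboolP/set0Pn => [[s ps]|[w]].
  have sz : size (mkseq s m) == m by rewrite size_mkseq.
  exists (Tuple sz); rewrite !inE; apply/asboolP; exists (shift m s).
  by rewrite /= catw_mkseq.
by rewrite !inE => /asboolP [u pu]; exists (catw w u).
Qed.

(** * Patterns with two prefixes *)

(* x c 1 0^K 1^oo *)
Definition flip_w (x : seq bool) (K : nat) (c : bool) : word2 := fun k =>
  if k < size x then nth false x k
  else if k == size x then c
  else (k == (size x).+1) || ((size x).+1 + K < k).

(* 1 0^K 1^oo *)
Definition high_w (K : nat) : word2 := fun k => (k == 0) || (K < k).

Lemma shift_flip_w x K c : shift (size x).+1 (flip_w x K c) = high_w K.
Proof.
apply/funext => k; rewrite /shift /flip_w /high_w.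
by case: ltnP; case: eqP; lia.
Qed.

(** If [s] starts with 1, its next 1 comes at some k <= K, where [high_w K] still has 0. Exactly one
    1 precedes k, so the order is reversed there and [s] is the smaller word. *)
Lemma high_w_gt (s : word2) K : (s 0 -> exists2 k, 0 < k <= K & s k) ->
  tent_lt s (high_w K).
Proof.
move=> sK; case s0: (s 0); last by apply/tent_lt_rec; rewrite s0.
move: (sK s0) => {}sK.
have exk : exists k, (0 < k <= K) && s k.
  by case: sK => k kK sk; exists k; rewrite kK.
case: (ex_minnP exk) => k /andP[/andP[k0 kK] sk] mink.
have sz i : 0 < i < k -> s i = false.
  move=> /andP[i0 ik]; apply/negbTE/negP => si.
  by have := mink i; rewrite i0 si (leq_trans (ltnW ik) kK) => /(_ isT); lia.
apply/tent_ltP; exists k; split.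
- by move=> [|i] ik; rewrite ?s0 // sz ?ik // /high_w /=; lia.
- by rewrite sk /high_w; lia.
case: k k0 kK sk mink sz => // k _ kK sk mink sz.
rewrite sk onesS s0 ones_sum big1 // => i _.
by rewrite /tent sz //; have := ltn_ord i; lia.
Qed.

Section Flip.

Variables (x : seq bool) (K : nat).
Hypothesis xK : size x < K.

Let i := size x.

Lemma flip_w_max c j : j <> i.+1 ->
  tent_lt (shift j (flip_w x K c)) (shift i.+1 (flip_w x K c)).
Proof.
move=> ji; rewrite shift_flip_w; apply: high_w_gt; rewrite shift_at0.
have [jle|jgt] := leqP j i => fj.
  (* For j <= i, the 1 at position i + 1 is at most i + 1 <= K letters away. *)
  exists (i.+1 - j); first by lia.
  by rewrite /shift subnKC ?(leqW jle) // /flip_w -/i;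
    case: ltnP => ?; first lia; case: eqP; lia.
have jK : i.+1 + K < j.
  by move: fj; rewrite /flip_w -/i; case: ltnP => ?; first lia; case: eqP; lia.
exists 1; first by lia.
by rewrite /shift addn1 /flip_w -/i; case: ltnP => ?; first lia; case: eqP; lia.
Qed.

(** Position i + 1 + K carries the last 0. The shift at [j] shows it where the shift at [k] already
    shows a 1 of the final run. *)
Lemma flip_w_inj c j k : j < k -> j <= i.+1 + K ->
  shift j (flip_w x K c) <> shift k (flip_w x K c).
Proof.
move=> jk jK /(congr1 (fun s => s (i.+1 + K - j))).
rewrite /shift /flip_w -/i.
by repeat (case: ltnP => ?; rewrite /=); repeat (case: eqP => ? /=); lia.
Qed.

Lemma flip_w_same j c : j <> i -> flip_w x K c j = flip_w x K false j.
Proof. by rewrite /flip_w -/i => ji; case: ltnP => //; case: eqP. Qed.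

(** Only the letter at i depends on [c], and it is never consulted: since i + 1 is the peak, a
    comparison with the shift at i is decided by the letter at the other position. *)
Lemma flip_w_order c j k : j <> k ->
  tent_lt (shift j (flip_w x K c)) (shift k (flip_w x K c)) <->
  tent_lt (shift j (flip_w x K false)) (shift k (flip_w x K false)).
Proof.
have tail l : i < l -> shift l (flip_w x K c) = shift l (flip_w x K false).
  by move=> il; apply/funext => r; rewrite /shift flip_w_same //; lia.
have at_i b l : l <> i ->
    (tent_lt (shift l (flip_w x K b)) (shift i (flip_w x K b)) <->
     ~~ flip_w x K false l) /\
    (tent_lt (shift i (flip_w x K b)) (shift l (flip_w x K b)) <->
     flip_w x K false l).
  move=> li; rewrite -(flip_w_same b li) -(shift_at0 l).
  by apply: tent_lt_head; rewrite -!shiftS; apply: flip_w_max; lia.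
(* [d] counts the steps left until both positions exceed i, where the two words have the same
   shifts. *)
have [d] : exists d, i < minn j k + d by exists i.+1; lia.
elim: d j k => [|d IHd] j k hd jk.
  by rewrite !tail //; lia.
have [ej|/eqP ji] := eqVneq j i.
  have ki : k <> i by lia.
  by rewrite ej (at_i c k ki).2 (at_i false k ki).2.
have [ek|/eqP ki] := eqVneq k i.
  by rewrite ek (at_i c j ji).1 (at_i false j ji).1.
rewrite [X in X <-> _]tent_lt_rec [X in _ <-> X]tent_lt_rec.
rewrite !shift_at0 -!shiftS (flip_w_same c ji) (flip_w_same c ki).
by case: eqP => // _; case: (flip_w _ _ _ _); apply: IHd; lia.
Qed.

End Flip.

Lemma flip_w_pat m (i : 'I_m) (x : i.-tuple bool) :
  exists p : 'S_m.+1, forall c, is_pat (flip_w x m c) p.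
Proof.
have xm : size x < m by rewrite size_tuple.
have [|p pp] := @is_pat_ex (flip_w x m false) m.+1.
  have lt_inj (j k : 'I_m.+1) : j < k ->
      shift j (flip_w x m false) <> shift k (flip_w x m false).
    by move=> jk; apply: flip_w_inj => //; have := ltn_ord j; lia.
  move=> j k /eqP; rewrite -val_eqE neq_ltn => /orP [/lt_inj //|/lt_inj kj e].
  exact: kj.
exists p => c; case/is_patP: pp => inj ord; apply/is_patP; split=> j k.
  move=> jk e; have nejk : (j : nat) <> k by move=> /val_inj.
  case: (tent_lt_total (inj j k jk)) => /(flip_w_order xm c _) h.
    by apply: (@tent_lt_irr (shift j (flip_w x m c))); rewrite {2}e; apply: h.
  apply: (@tent_lt_irr (shift j (flip_w x m c))); rewrite {1}e; apply: h.
  exact: nesym.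
rewrite ord; have [->|/eqP jk] := eqVneq j k; first by split=> /tent_lt_irr.
by rewrite flip_w_order // => /val_inj.
Qed.

Lemma flip_w_peak m (i : 'I_m) (x : i.-tuple bool) (p : 'S_m.+1) c :
  is_pat (flip_w x m c) p -> peak p i.
Proof.
move=> /is_patP [_ h] j ji; apply/h; rewrite !lift0.
have := @flip_w_max x m _ c j.+1; rewrite size_tuple; apply=> //.
by move=> [/val_inj].
Qed.

(** The words x c 1 0^m 1^oo with x of length i < m give 1 + 2 + ... + 2^(m-1) patterns. These are
    distinct: the peak of the pattern returns i, and [peak_letter] then returns x. *)
Lemma card_two_prefixes m :
  2 ^ m - 1 <= #|[set p : 'S_m.+1 | 1 < #|pat_prefixes p|]|.
Proof.
have [h hP] := boolp.choice
  (fun ix : {i : 'I_m & i.-tuple bool} => flip_w_pat (tagged ix)).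
have h_inj : injective h.
  move=> [i x] [j y] hE; have := hP (Tagged _ y); have := hP (Tagged _ x).
  rewrite /= hE => px py.
  have pi := flip_w_peak (px false); have pj := flip_w_peak (py false).
  have eij := peak_uniq pi pj; subst j; congr Tagged; apply: eq_from_tnth => k.
  have km : k < m by apply: ltn_trans (ltn_ord i).
  have ki : Ordinal km <> i.
    by move=> /(congr1 val) /= e; have := ltn_ord k; rewrite e ltnn.
  have := peak_letter (px false) pi ki; have := peak_letter (py false) pi ki.
  by rewrite /flip_w !size_tuple /= !ltn_ord !(tnth_nth false) => -> ->.
have card_ix : #|{: {i : 'I_m & i.-tuple bool}}| = 2 ^ m - 1.
  rewrite card_tagged sumnE big_map big_enum /=.
  under eq_bigr => i _ do rewrite card_tuple card_bool.
  by rewrite subn1 predn_exp mul1n.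
rewrite -card_ix -cardsT -(card_imset _ h_inj); apply: subset_leq_card.
apply/subsetP => p /imsetP [[i x] _ ->]; rewrite inE.
have := hP (Tagged (fun i : 'I_m => i.-tuple bool) x); rewrite /= => px.
set q := h _ in px *.
have sz c : size (mkseq (flip_w x m c) m) == m by rewrite size_mkseq.
have in_q c : Tuple (sz c) \in pat_prefixes q.
  rewrite !inE; apply/asboolP; exists (shift m (flip_w x m c)).
  by rewrite /= catw_mkseq.
have ne : Tuple (sz true) != Tuple (sz false).
  apply/eqP => /(congr1 (fun w : m.-tuple bool => nth false w i)) /=.
  by rewrite !nth_mkseq // /flip_w size_tuple ltnn eqxx.
apply: (@leq_trans #|[set Tuple (sz true); Tuple (sz false)]|).
  by rewrite cards2 ne.
by apply: subset_leq_card; apply/subsetP => w /set2P [] ->.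
Qed.

(** * Double counting of prefixes and patterns, and the two bounds *)

Lemma sum_pat_prefixes m :
  \sum_(p : 'S_m.+2) #|pat_prefixes p| = a m.+2 + 2 ^ m.
Proof.
transitivity (\sum_(w : m.+1.-tuple bool) #|prefix_pats w|); last first.
  under eq_bigr => w _ do rewrite card_prefix_pats.
  by rewrite big_split /= sum_primitive_suffixes sum_last_letter.
transitivity (\sum_(p : 'S_m.+2)
    \sum_(w : m.+1.-tuple bool) (p \in prefix_pats w : nat)).
  apply: eq_bigr => p _; rewrite -sum1_card big_mkcond /=.
  by apply: eq_bigr => w _; rewrite [w \in _]inE; case: (p \in _).
rewrite exchange_big /=; apply: eq_bigr => w _.
rewrite -sum1_card [RHS]big_mkcond /=; apply: eq_bigr => p _.
by case: (p \in _).
Qed.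

Lemma allowed_lower m : a m.+2 + 2 ^ m <= 2 * #|allowed m.+2|.
Proof.
rewrite -sum_pat_prefixes mulnC -sum_nat_const [X in _ <= X]big_mkcond /=.
apply: leq_sum => p _; rewrite allowed_prefixes; case: posnP => [->//|_].
exact: pat_prefixes_le2.
Qed.

(** A pattern with two prefixes is counted once on the left as allowed and once more for its second
    prefix. *)
Lemma allowed_upper m : #|allowed m.+2| + (2 ^ m.+1 - 1) <= a m.+2 + 2 ^ m.
Proof.
apply: leq_trans (leq_add (leqnn _) (card_two_prefixes m.+1)) _.
rewrite -sum_pat_prefixes -!sum1_card !(big_mkcond (fun p => p \in _)) /=.
rewrite -big_split /=; apply: leq_sum => p _; rewrite allowed_prefixes inE.
by case: #|_| => [|[|k]].
Qed.

Import Order.TTheory GRing.Theory Num.Theory.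
Local Open Scope ring_scope.

Theorem theorem3p3 (n : nat) (hn : (2 <= n)%N) :
  2^-1 * ((a n)%:R + 2 ^+ (n - 2)) <= #|allowed n|%:R :> rat /\
  #|allowed n|%:R <= (a n)%:R - 2 ^+ (n - 2) + 1 :> rat.
Proof.
case: n hn => [|[|m]] // _; rewrite subn2 /=.
have := allowed_lower m; have := allowed_upper m.
have : (0 < 2 ^ m)%N by rewrite expn_gt0.
rewrite expnS => e0 hi lo.
have {}lo : (a m.+2 + 2 ^ m)%:R <= (2 * #|allowed m.+2|)%:R :> rat.
  by rewrite ler_nat.
(* The truncated subtraction in [allowed_upper] is a true one since [2 ^ m] is positive; one copy of
   [2 ^ m] cancels. *)
have {}hi : (#|allowed m.+2| + 2 ^ m)%:R <= (a m.+2 + 1)%:R :> rat.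
  by rewrite ler_nat; lia.
move: lo hi; rewrite natrM !natrD natrX => lo hi; split; lra.
Qed.
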